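(* Let $G$ be a graph, let $f$ be a positive integer-valued function on $V(G)$, let $a$ be a real number with $1<a\le f(v)$ for all $v$, and let $h$ be a nonnegative real function on $V(G)$. For each vertex $v$ let $\varepsilon_0(v)=1$ if $a$ is an integer with $a\equiv f(v)\pmod 2$, and $\varepsilon_0(v)=0$ otherwise, and define $$t(v)=\frac{1}{4(a-1)}\Big(\big(f(v)+a-1\big)^2-4h(v)-\varepsilon_0(v)\Big).$$ Suppose $G$ is $t$-iso-tough and that for every $S\subseteq V(G)$ and every set $I_*$ obtained by choosing one center vertex from each star component of $G\setminus S$, $$\sum_{v\in I_*}\big(f(v)+h(v)-1\big)+\omega(G\setminus S)\le |S|+1.$$ Then $G$ has a near $f$-factor.
   Context: Graphs are finite, have no loops, but may have multiple edges; degrees count multiplicities. For $S\subseteq V(G)$, $G\setminus S$ is the graph obtained by deleting $S$, $\omega(\cdot)$ is the number of connected components, and $I(G\setminus S)$ is the set of isolated vertices of $G\setminus S$. For a real function $t$ on $V(G)$, $G$ is $t$-iso-tough if $\sum_{v\in I(G\setminus S)}t(v)\le |S|$ for all $S\subseteq V(G)$. A star component is a component isomorphic to $K_{1,k}$ for some $k\ge 0$ (so isolated vertices and single edges are stars); its center is the vertex of degree $k$ (for $K_1$ the vertex itself, for $K_{1,1}$ either end). A near $f$-factor is a spanning subgraph $F$ with $d_F(v)=f(v)$ for all vertices $v$, except for at most one vertex $u$ with $d_F(u)=f(u)+1$. *)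

(* Defs.v *)
From HB Require Import structures.
From mathcomp Require Import all_boot all_order all_algebra.
Set Implicit Arguments. Unset Strict Implicit. Unset Printing Implicit Defensive.
Import Order.TTheory GRing.Theory Num.Theory.

(* A finite loopless multigraph on vertex type T is given by an edge
   multiplicity function m : T -> T -> nat, symmetric with m v v = 0. *)
Definition multigraph (T : finType) (m : T -> T -> nat) : Prop :=
  (forall u v, m u v = m v u) /\ (forall v, m v v = 0%N).

Definition deg (T : finType) (m : T -> T -> nat) (v : T) : nat :=
  (\sum_(u : T) m v u)%N.

Definition adjS (T : finType) (m : T -> T -> nat) (S : {set T}) : rel T :=
  fun x y => [&& x \notin S, y \notin S & (0 < m x y)%N].

Definition sameComp (T : finType) (m : T -> T -> nat) (S : {set T}) (x y : T) : bool :=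
  connect (adjS m S) x y.

Definition omega (T : finType) (m : T -> T -> nat) (S : {set T}) : nat :=
  n_comp (adjS m S) [predC S].

Definition isoSet (T : finType) (m : T -> T -> nat) (S : {set T}) : {set T} :=
  [set v | (v \notin S) && [forall u, (u \notin S) ==> (m v u == 0%N)]].

Definition starCenter (T : finType) (m : T -> T -> nat) (S : {set T}) (c : T) : Prop :=
  c \notin S /\
  (forall x, x != c -> x \notin S -> sameComp m S c x -> m c x = 1%N) /\
  (forall x y, x != c -> y != c -> x \notin S -> y \notin S ->
     sameComp m S c x -> sameComp m S c y -> m x y = 0%N).

Definition starCenterChoice (T : finType) (m : T -> T -> nat) (S I : {set T}) : Prop :=
  (forall x, x \in I -> starCenter m S x) /\
  (forall x y, x \in I -> y \in I -> sameComp m S x y -> x = y) /\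
  (forall c, starCenter m S c -> exists2 x, x \in I & sameComp m S x c).

Definition spanningSub (T : finType) (m F : T -> T -> nat) : Prop :=
  (forall u v, F u v = F v u) /\ (forall u v, (F u v <= m u v)%N).

Definition near_factor (T : finType) (m : T -> T -> nat) (f : T -> nat) : Prop :=
  exists F : T -> T -> nat, spanningSub m F /\
    exists2 U : {set T}, (#|U| <= 1)%N &
      forall v, deg F v = (if v \in U then (f v).+1 else f v).

Local Open Scope ring_scope.

Definition iso_tough (R : numDomainType) (T : finType) (m : T -> T -> nat)
  (t : T -> R) : Prop :=
  forall S : {set T}, \sum_(v in isoSet m S) t v <= (#|S|)%:R.

Definition eps0 (R : archiRealFieldType) (a : R) (fv : nat) : R :=
  if (a \is a Num.int) && ~~ odd `|Num.floor a - (fv%:Z)|%N then 1 else 0.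

Definition tfun (R : archiRealFieldType) (T : finType) (f : T -> nat) (a : R)
  (h : T -> R) (v : T) : R :=
  (((f v)%:R + a - 1) ^+ 2 - 4 * h v - eps0 a (f v)) / (4 * (a - 1)).

(* Main.v *)
Require Import Defs.
From HB Require Import structures.
From mathcomp Require Import all_boot all_order all_algebra zify ring lra.
From Stdlib Require Import Classical.
Set Implicit Arguments. Unset Strict Implicit. Unset Printing Implicit Defensive.
Import Order.TTheory GRing.Theory Num.Theory.
Local Open Scope ring_scope.

(** Let [d] be the l1-distance from [f] to the degree sequences of the spanning subgraphs of [G].
    Degree sequences form a jump system, being a sum of the two-point systems [{0, e_u + e_v}]
    over the edges [uv], and so do the vectors at distance at most [k] of the right parity; all
    exchanges along alternating trails reduce to this fact.  If moving [f] up at a vertex brings it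
    closer to a degree sequence but moving it down does not, the vertex can be deleted and put into
    a set [A] without loss; symmetrically for a set [B].  When no such vertex is left, Gallai's
    argument shows that each component accounts for at most one unit of distance.  Hence if
    [d >= 2] there are disjoint [A], [B] with
    [omega (G - A - B) >= f(A) + sum_(v in B) (x v - f v) + 2], where [x v] is the degree of [v] in
    [G - A]; the cases [d <= 1] yield a near factor as soon as all degrees are at least [f].

    Toughness excludes such a pair.  Choose an independent set [I] in [B] greedily by decreasing
    [f - x].  Iso-toughness is applied to [A] together with the neighbours of those [i] in [I] with
    [x i <= f i], the condition on stars to [A], [B \ I] and most neighbours of [I] outside [B], so
    that the elements of [I] become centers of stars.  Adding [a - 1] times the first inequality to
    the second and using [((f + a - 1)^2 - eps0) / 4 >= x (f - x) + (a - 1) x] contradicts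
    [f(A) >= a |A|]. *)

(** * Jump systems *)

Definition vec (T : finType) (s : bool * T) : {ffun T -> int} :=
  [ffun v => if v == s.2 then (if s.1 then 1 else - 1) else 0].

Ltac ffun_ring := do ?[move: (vec _) => ?]; apply/ffunP=> ?; rewrite !ffunE; ring.

Section Jump.
Variable T : finType.
Notation vect := {ffun T -> int}.
Implicit Types (x y g : vect) (s t : bool * T) (J K : vect -> Prop).

Definition sopp s : bool * T := (~~ s.1, s.2).
(** [0 < along s (y - x)] says that the step [s] leads from [x] towards [y], shortening the
    l1-distance. *)
Definition along s x : int := (if s.1 then 1 else - 1) * x s.2.
Definition norm1 x : nat := (\sum_v `|x v|)%N.

Lemma vec_sopp s : vec (sopp s) = - vec s.
Proof. by apply/ffunP=> v; rewrite !ffunE /=; case: s.1; case: eqP. Qed.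

Lemma alongD s x y : along s (x + y) = along s x + along s y.
Proof. by rewrite /along ffunE mulrDr. Qed.

Lemma alongN s x : along s (- x) = - along s x.
Proof. by rewrite /along ffunE mulrN. Qed.

Lemma along0 s : along s 0 = 0.
Proof. by rewrite /along ffunE mulr0. Qed.

Lemma along_sopp s x : along (sopp s) x = - along s x.
Proof. by rewrite /along /=; case: s.1 => /=; lia. Qed.

Lemma along_vec s t : along s (vec t) = (s == t)%:Z - (s == sopp t)%:Z.
Proof.
case: s t => [b u] [c w]; rewrite /along ffunE /sopp !xpair_eqE /=.
by case: (u == w); case: b; case: c.
Qed.

Lemma along_vv s : along s (vec s) = 1.
Proof. by case: s => [[] u]; rewrite /along ffunE eqxx. Qed.

Lemma norm1_step s x : 0 < along s x -> (norm1 (x - vec s)%R < norm1 x)%N.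
Proof.
case: s => b u; rewrite /along /norm1 /= => h.
rewrite (bigD1 u) //= [in X in (_ < X)%N](bigD1 u) //= !ffunE eqxx /=.
rewrite (eq_bigr (fun v => `|x v|%N)); first by case: b h => /= h; lia.
by move=> v /negPf vu; rewrite !ffunE vu subr0.
Qed.

(* No [t] exists when [x + vec s = y]: the axiom thus forces the coordinate sums of all elements
   of [J] to have the same parity. *)
Definition jump J := forall x y s, J x -> J y -> 0 < along s (y - x) ->
  exists2 t, 0 < along t (y - (x + vec s)) & J (x + vec s + vec t).

Definition sumset J K z := exists x k, [/\ J x, K k & z = x + k].

Lemma jump_ext J K : (forall z, J z <-> K z) -> jump J -> jump K.
Proof.
move=> JK jJ x y s /JK Jx /JK Jy h; have [t ht /JK] := jJ x y s Jx Jy h.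
by exists t.
Qed.

(** If [s] does not lead towards [y], undoing it does, and that returns to [x]. *)
Lemma jump_any J x y s : jump J -> J x -> J y ->
  exists2 t, 0 < along t (y - (x + vec s)) & J (x + vec s + vec t).
Proof.
move=> jJ Jx Jy; have [h|h] := ltrP 0 (along s (y - x)); first exact: jJ.
exists (sopp s); last by rewrite vec_sopp addrK.
rewrite opprD addrA along_sopp alongD alongN along_vv.
by move: (along _ _) h => p; lia.
Qed.

(** Induction on the distance between the decompositions: if one summand answers [s] by [t], then
    the first step [sopp t] from the new, closer decomposition leads to the same intermediate
    point. *)
Lemma jump_sumset J K : jump J -> jump K -> jump (sumset J K).
Proof.
move=> jJ jK.
(* Nothing is known about the direction of [sopp t], so [s] is arbitrary here. *)
suff gen n x y k l s : (norm1 (y - x)%R + norm1 (l - k)%R < n)%N ->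
    J x -> J y -> K k -> K l ->
    exists2 t, 0 < along t (y + l - (x + k + vec s)) &
      sumset J K (x + k + vec s + vec t).
  move=> _ _ s [x [k [Jx Kk ->]]] [y [l [Jy Kl ->]]] _.
  exact: (gen _ x y k l s (ltnSn _)).
elim: n x k s => // n IHn x k s; rewrite ltnS => le_n Jx Jy Kk Kl.
have [h|h] := ltrP 0 (along s (y - x)).
  have [t ht Jt] := jJ _ _ _ Jx Jy h.
  have eZ : x + vec s + vec t + k + vec (sopp t) = x + k + vec s.
    by rewrite vec_sopp; ffun_ring.
  rewrite -eZ; apply: (IHn (x + vec s + vec t) k (sopp t)) => //.
  apply: leq_trans le_n; rewrite ltn_add2r.
  rewrite opprD addrA; apply: (ltn_trans (norm1_step ht)).
  by rewrite opprD addrA; apply: norm1_step.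
have [h'|h'] := ltrP 0 (along s (l - k)).
  have [t ht Kt] := jK _ _ _ Kk Kl h'.
  have eZ : x + (k + vec s + vec t) + vec (sopp t) = x + k + vec s.
    by rewrite vec_sopp; ffun_ring.
  rewrite -eZ; apply: (IHn x (k + vec s + vec t) (sopp t)) => //.
  apply: leq_trans le_n; rewrite ltn_add2l.
  rewrite opprD addrA; apply: (ltn_trans (norm1_step ht)).
  by rewrite opprD addrA; apply: norm1_step.
exists (sopp s); last by rewrite vec_sopp addrK; exists x, k.
have -> : y + l - (x + k + vec s) = (y - x) + (l - k) - vec s.
  by ffun_ring.
rewrite along_sopp alongD (alongD s (y - x)) (alongN _ (vec s)) along_vv.
by move: h h'; move: (along _ _) (along _ _) => p q; lia.
Qed.

Lemma jump_steps : jump (fun z => exists s, z = vec s).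
Proof.
move=> _ _ s [u ->] [w ->]; rewrite alongD alongN !along_vec => h.
have [su|su] := eqVneq s (sopp u).
  exists w; last by exists w; rewrite su vec_sopp addrN add0r.
  rewrite su vec_sopp addrN subr0 along_vec eqxx.
  by case: eqP => // /(congr1 fst) /=; case: w.1.
have [sw|sw] := eqVneq s w; last by move: h; rewrite (negPf su) (negPf sw); lia.
exists (sopp u); last by exists w; rewrite sw vec_sopp addrAC addrN add0r.
rewrite sw opprD addrCA addrN addr0 -vec_sopp along_vec eqxx.
by case: eqP => // /(congr1 fst) /=; case: u.1.
Qed.

End Jump.

(** * Degree sequences of spanning subgraphs *)

Section Degrees.
Variable T : finType.
Notation vect := {ffun T -> int}.
Implicit Types (m F : T -> T -> nat) (g : vect) (s t : bool * T).

Notation up v := (vec (true, v)).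
Notation down v := (vec (false, v)).

Definition degs m g := exists2 F, spanningSub m F & forall v, g v = (deg F v)%:Z.

Definition edge (u v x y : T) : nat :=
  ((x == u) && (y == v) || (x == v) && (y == u))%N.

Definition minus_edge m u v : T -> T -> nat := fun x y => (m x y - edge u v x y)%N.
Definition plus_edge m u v : T -> T -> nat := fun x y => (m x y + edge u v x y)%N.

Lemma edgeC u v x y : edge u v x y = edge u v y x.
Proof. by rewrite /edge orbC ![(_ == u) && _]andbC ![_ && (_ == u)]andbC. Qed.

Lemma edge_cases u v x y : edge u v x y = 0%N \/
  edge u v x y = 1%N /\ forall F, (forall x y, F x y = F y x) -> F x y = F u v.
Proof.
rewrite /edge; case: andP => [[/eqP -> /eqP ->]|_]; first by right.
by case: andP => [[/eqP -> /eqP ->]|_]; [right|left].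
Qed.

Lemma deg_edge u v w : u != v -> deg (edge u v) w = ((w == u) + (w == v))%N.
Proof.
move=> uv; rewrite /deg /edge.
have [->|wu] := eqVneq w u.
  by rewrite (bigD1 v) //= eqxx big1 ?addn0 ?(negPf uv) // => y /negPf ->.
have [_|_] := eqVneq w v; last by rewrite big1.
by rewrite (bigD1 u) //= eqxx big1 // => y /negPf ->.
Qed.

Lemma deg_plus_edge F u v w : u != v ->
  deg (plus_edge F u v) w = (deg F w + (w == u) + (w == v))%N.
Proof. by move=> uv; rewrite -addnA -deg_edge // /deg -big_split. Qed.

Lemma minus_edge_multigraph m u v : multigraph m -> multigraph (minus_edge m u v).
Proof.
by move=> [mC m0]; split=> [x y|x]; rewrite /minus_edge ?m0 // mC edgeC.
Qed.

Lemma multigraph_neq m u v : multigraph m -> (0 < m u v)%N -> u != v.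
Proof. by move=> [_ m0]; apply: contraTneq => ->; rewrite m0. Qed.

Lemma degs_mono m m' g : (forall x y, m x y <= m' x y)%N -> degs m g -> degs m' g.
Proof.
move=> le_m [F [FC Fm] eF]; exists F => //; split=> // x y.
exact: leq_trans (Fm x y) (le_m x y).
Qed.

Lemma minus_edgeS F u v : (forall x y, F x y = F y x) -> (0 < F u v)%N ->
  F =2 plus_edge (minus_edge F u v) u v.
Proof.
move=> FC F0 x y; rewrite /plus_edge /minus_edge.
by case: (edge_cases u v x y) => [->|[-> ->]]; rewrite ?subn0 ?addn0 ?subnK.
Qed.

Lemma degs_edge m u v g : multigraph m -> (0 < m u v)%N ->
  degs m g <-> degs (minus_edge m u v) g \/ degs (minus_edge m u v) (g - up u - up v).
Proof.
move=> mm m0; have uv := multigraph_neq mm m0; have [mC _] := mm; split.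
  move=> [F [FC Fm] eF]; have [F_lt|F_ge] := ltnP (F u v) (m u v).
    left; exists F => //; split=> // x y; move: (Fm x y).
    rewrite /minus_edge; case: (edge_cases u v x y) => [->|[-> eqF]].
      by rewrite subn0.
    by rewrite !eqF //; lia.
  have F0 := leq_trans m0 F_ge.
  right; exists (minus_edge F u v).
    split=> x y; first by rewrite /minus_edge FC edgeC.
    by rewrite leq_sub2r.
  move=> w; have: deg F w = deg (plus_edge (minus_edge F u v) u v) w.
    by apply: eq_bigr => y _; apply: minus_edgeS.
  rewrite deg_plus_edge // !ffunE eF /= => ->.
  by case: (w == u); case: (w == v); lia.
move=> [|[F [FC Fm] eF]].
  by apply: degs_mono => x y; apply: leq_subr.
exists (plus_edge F u v).
  split=> x y; first by rewrite /plus_edge FC edgeC.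
  rewrite (minus_edgeS mC m0) /plus_edge leq_add2r; exact: Fm.
move=> w; rewrite deg_plus_edge //; move: (eF w); rewrite !ffunE /=.
by case: (w == u); case: (w == v); lia.
Qed.

Lemma jump_pair (p q : bool * T) : jump (fun z => z = 0 \/ z = vec p + vec q).
Proof.
have step (r r' : bool * T) : along r' (vec r + vec r' - (0 + vec r)) = 1.
  by rewrite add0r addrAC subrr add0r along_vv.
have step' (r r' : bool * T) :
    along (sopp r') (- (vec r + vec r' + vec (sopp r))) = 1.
  by rewrite (vec_sopp r) (addrC (vec r)) addrK -vec_sopp along_vv.
move=> x y s [->|->] [->|->]; rewrite ?subrr ?along0 // ?subr0 ?sub0r.
  rewrite alongD !along_vec.
  have [->|sp] := eqVneq s p; first by exists q; rewrite ?step // add0r; right.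
  have [->|sq] := eqVneq s q; last by lia.
  by exists p; rewrite (addrC (vec p)) ?step // add0r; right.
rewrite alongN alongD !along_vec.
have [->|sp] := eqVneq s (sopp p).
  by exists (sopp q); rewrite ?step' // !vec_sopp; left; ffun_ring.
have [->|sq] := eqVneq s (sopp q); last by lia.
exists (sopp p); rewrite 1?(addrC (vec p)) ?step' // !vec_sopp; left.
by ffun_ring.
Qed.

Lemma jump_degs m : multigraph m -> jump (degs m).
Proof.
have [n] := ubnP (\sum_x \sum_y m x y)%N; elim: n m => // n IHn m.
rewrite ltnS => le_n mm.
case: (pickP (fun p : T * T => 0 < m p.1 p.2)%N) => [[u v] /= m0|m0]; last first.
  have d0 g : degs m g -> g = 0.
    case=> F [FC Fm] eF; apply/ffunP=> v; rewrite eF ffunE /deg big1 // => w _.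
    by move: (Fm v w) (m0 (v, w)) => /=; lia.
  by move=> x y s /d0 -> /d0 ->; rewrite subrr along0.
have uv := multigraph_neq mm m0.
have mm' := minus_edge_multigraph u v mm.
have jE := @jump_pair (true, u) (true, v).
apply: (@jump_ext _ (sumset (degs (minus_edge m u v)) (fun z => z = 0 \/ z = up u + up v))).
  move=> z; rewrite (degs_edge _ mm m0); split.
    move=> [x [k [dx [->|->] ->]]]; rewrite ?addr0; first by left.
    by right; congr degs: dx; ffun_ring.
  case=> dz; first by exists z, 0; split; [|left|rewrite addr0].
  by exists (z - up u - up v), (up u + up v); split; [|right|ffun_ring].
apply: jump_sumset jE; apply: IHn => //; apply: leq_trans le_n.
rewrite (bigD1 u) //= [in X in (_ < X)%N](bigD1 u) //= -addSn leq_add //; last first.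
  by apply: leq_sum => x _; apply: leq_sum => y _; apply: leq_subr.
rewrite (bigD1 v) //= [in X in (_ < X)%N](bigD1 v) //= -addSn leq_add //; last first.
  by apply: leq_sum => x _; apply: leq_subr.
by rewrite /minus_edge /edge !eqxx /=; lia.
Qed.
End Degrees.

(** * Distance from the degree sequences *)

Section Levels.
Variable T : finType.
Notation vect := {ffun T -> int}.
Implicit Types (m F : T -> T -> nat) (f g z : vect) (s t : bool * T).
Notation up v := (vec (true, v)).
Notation down v := (vec (false, v)).

(* Steps may cancel out, so [lev m k g] implies [lev m k.+2 g]; it never implies [lev m k.+1 g]. *)
Definition lev m k g :=
  exists2 st : seq (bool * T), size st = k & degs m (g + \sum_(s <- st) vec s).

Lemma lev0 m g : lev m 0 g <-> degs m g.
Proof.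
split=> [[st /size0nil ->]|dg]; first by rewrite big_nil addr0.
by exists [::]; rewrite // big_nil addr0.
Qed.

Lemma levS m k g : lev m k.+1 g <-> exists s, lev m k (g + vec s).
Proof.
split=> [[[|s st] //= [sz]]|[s [st sz]]].
  by rewrite big_cons addrA => dg; exists s, st.
by move=> dg; exists (s :: st); rewrite /= ?sz // big_cons addrA.
Qed.

Lemma lev_step m k g s : lev m k g -> lev m k.+1 (g + vec s).
Proof. by move=> lg; apply/levS; exists (sopp s); rewrite vec_sopp addrK. Qed.

Lemma lev_steps m k g s n : lev m k g -> lev m (k + n) (g + vec s *+ n).
Proof.
move=> lg; elim: n => [|n IHn]; first by rewrite addn0 mulr0n addr0.
by rewrite addnS mulrSr addrA; apply: lev_step.
Qed.

Lemma lev_mono m m' k g : (forall x y, m x y <= m' x y)%N -> lev m k g -> lev m' k g.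
Proof. by move=> le_m [st sz dg]; exists st => //; apply: degs_mono dg. Qed.

Lemma lev_edge m u v k g : multigraph m -> (0 < m u v)%N ->
  lev m k g <-> lev (minus_edge m u v) k g \/ lev (minus_edge m u v) k (g - up u - up v).
Proof.
move=> mm m0; split.
  move=> [st sz /(degs_edge _ mm m0) [dg|dg]]; [left|right]; exists st => //.
  by congr degs: dg; move: (\sum_(_ <- _) _) => ?; ffun_ring.
case=> -[st sz dg]; exists st => //; apply/(degs_edge _ mm m0); [by left|right].
by congr degs: dg; move: (\sum_(_ <- _) _) => ?; ffun_ring.
Qed.

Lemma lev_exists m g : exists k, lev m k g.
Proof.
have [n] := ubnP (norm1 g); elim: n g => // n IHn g; rewrite ltnS => le_n.
have [/forallP g0|] := boolP [forall v, g v == 0].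
  exists 0%N; apply/lev0; exists (fun _ _ => 0%N); first by [].
  by move=> v; rewrite (eqP (g0 v)) /deg big1.
rewrite negb_forall => /existsP[v gv0].
pose s := (0 < g v, v).
have hs : 0 < along s g by move: gv0; rewrite /along /s /=; move: (g v) => c; case: (ltrP 0 c); lia.
have [|k lk] := IHn (g - vec s); first exact: leq_trans (norm1_step hs) le_n.
by exists k.+1; rewrite -(subrK (vec s) g); apply: lev_step.
Qed.

(** Each level is the previous one plus the set of signed unit vectors, which is closed under
    negation. *)
Lemma jump_lev m k : multigraph m -> jump (lev m k).
Proof.
move=> mm; elim: k => [|k IHk].
  by apply: (jump_ext _ (jump_degs mm)) => z; split=> /lev0.
apply: (jump_ext _ (jump_sumset IHk (@jump_steps T))) => z; split.
  by move=> [x [_ [lx [s ->] ->]]]; apply: lev_step.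
move=> /levS[s ls]; exists (z + vec s), (- vec s); split=> //; last by rewrite addrK.
by exists (sopp s); rewrite vec_sopp.
Qed.

Lemma along_sum t st : 0 < along t (\sum_(s <- st) vec s) -> t \in st.
Proof.
elim: st => [|s st IHst]; first by rewrite big_nil along0.
rewrite big_cons alongD along_vec in_cons.
case: eqP => //= _ h; apply: IHst; move: h.
by move: (along _ _) => c; case: (_ == _); lia.
Qed.

(* All alternating-trail arguments below are instances of this lemma. *)
Lemma lev_between m k z st : multigraph m ->
  lev m k.+1 z -> lev m k (z + \sum_(s <- st) vec s) ->
  exists2 t, t \in st & lev m k (z + vec t).
Proof.
move=> mm /levS[s ls] ly.
(* From [z + vec s] the first step goes back to [z]; the answer [t] then leads from [z] towards the
   other point, so it occurs in [st]. *)
have [t] := jump_any (sopp s) (@jump_lev m k mm) ls ly.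
rewrite vec_sopp addrK addrAC subrr add0r => /along_sum st_t lt.
by exists t.
Qed.

Lemma lev_parity m k g : multigraph m -> lev m k g -> lev m k.+1 g -> False.
Proof.
move=> mm lk lk1; have [|t] := @lev_between m k g [::] mm lk1; last by [].
by rewrite big_nil addr0.
Qed.

(** A point of the ray that is too close and a point beyond [f] on the other side are joined by
    steps [sopp s] only, so [lev_between] makes the preceding point of the ray too close as well. *)
Lemma lev_ray m d f s : multigraph m ->
  (forall k, (k < d.+1)%N -> ~ lev m k f) -> lev m d.+1 f ->
  lev m d (f - vec s) -> ~ lev m d (f + vec s) ->
  forall n j, lev m j (f + vec s *+ n) -> (d.+1 + n <= j)%N.
Proof.
move=> mm fmin lf lfN nlf; elim=> [|n IHn] j lj.
  by rewrite addn0 leqNgt; apply/negP=> /fmin; rewrite mulr0n addr0 in lj.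
have j1 : (d.+1 + n <= j.+1)%N.
  apply: IHn; have := lev_step (sopp s) lj.
  by rewrite vec_sopp mulrSr addrA addrK.
have [//|lt_j] := leqP (d.+1 + n.+1) j.
have [jE|jE] : j = (d + n)%N \/ j = (d + n).+1 by lia.
- case: n => [|n] in IHn lj j1 lt_j jE *.
    by case: nlf; rewrite -(addn0 d) -jE; move: lj; rewrite mulr1n.
  have ly := lev_steps (sopp s) n lfN.
  rewrite addnS in jE; rewrite jE in lj.
  (* It takes [n + n + 3] steps from [f + (n + 2) s] down to [f - (n + 1) s]. *)
  have [|t] := @lev_between m (d + n) _ (nseq (n + n + 3) (sopp s)) mm lj.
    congr lev: ly; rewrite big_nseq iter_addr_0 !vec_sopp.
    by move: (vec s) => p; apply/ffunP=> v; rewrite !(ffunMnE, ffunE); ring.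
  rewrite mem_nseq => /andP[_ /eqP ->].
  by rewrite vec_sopp mulrSr addrA addrK => /IHn; lia.
- have := lev_steps s n.+1 lf; rewrite addSn addnS => l2.
  by rewrite jE in lj; case: (lev_parity mm lj l2).
Qed.

(** Delete one copy of [uv]. Whether or not [f] uses it, one of the good moves at [u] becomes two
    steps at [u] and one at [v]; any of them, with the edge put back if necessary, yields a good
    move at [v]. *)
Lemma lev_no_edge m d f u v : multigraph m -> (0 < m u v)%N -> lev m d.+1 f ->
  lev m d (f + up u) -> lev m d (f + down u) ->
  ~ lev m d (f + up v) -> ~ lev m d (f + down v) -> False.
Proof.
move=> mm m0 lf lu lu' nlv nlv'.
have mm' := minus_edge_multigraph u v mm.
have E g := lev_edge d g mm m0.
have [n1 n2] : ~ lev (minus_edge m u v) d (f + up v) /\ ~ lev (minus_edge m u v) d (f - up u).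
  split=> h; apply: nlv; apply/E; [by left|right].
  by congr lev: h; ffun_ring.
have n3 : ~ lev (minus_edge m u v) d (f - up v).
  by move=> h; apply: nlv'; apply/E; left; rewrite (vec_sopp (true, v)).
have [l|l] := (lev_edge _ _ mm m0).1 lf.
  have ly : lev (minus_edge m u v) d (f + \sum_(s <- [:: sopp (true, u); sopp (true, u); sopp (true, v)]) vec s).
    move/E: lu' => [h|h]; rewrite (vec_sopp (true, u)) in h; first by [].
    by congr lev: h; rewrite !big_cons big_nil !vec_sopp; ffun_ring.
  have [t] := lev_between mm' l ly.
  by rewrite !inE => /or3P[] /eqP ->; rewrite vec_sopp.
have ly : lev (minus_edge m u v) d (f - up u - up v + \sum_(s <- [:: (true, u); (true, u); (true, v)]) vec s).
  move/E: lu => [h|h]; first by congr lev: h; rewrite !big_cons big_nil; ffun_ring.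
  by case: n3; congr lev: h; ffun_ring.
have [t] := lev_between mm' l ly.
rewrite !inE => /or3P[] /eqP -> h.
- by case: n3; congr lev: h; ffun_ring.
- by case: n3; congr lev: h; ffun_ring.
- by case: n2; congr lev: h; ffun_ring.
Qed.

(** * Gallai's relation on flexible vertices *)

Section Apart.
Variables (m : T -> T -> nat) (e : nat) (f : vect).
Hypotheses (mm : multigraph m) (nlf : ~ lev m e f).

(** Meant for [f] at distance [e + 2]: steps at [p] and [q] never remove two units together. *)
Definition apart p q := forall s t, s.2 = p -> t.2 = q -> ~ lev m e (f + vec s + vec t).
Definition flexible q := forall b, lev m e.+1 (f + vec (b, q)).

Lemma same_vertex s t : s.2 = t.2 -> s = t \/ s = sopp t.
Proof. by case: s t => [[] u] [[] v] /= ->; [left|right|right|left]. Qed.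

(** Opposite steps cancel. If [f + 2 s] were in level [e], the only step from [f - s] towards it
    would put [f] there. *)
Lemma apart_refl p : flexible p -> apart p p.
Proof.
move=> Fp s t sp tp; have [->|->] := same_vertex (etrans tp (esym sp)); last first.
  by rewrite vec_sopp addrK.
move=> l2; have [||t'] := @lev_between m e (f + vec (sopp s)) [:: s; s; s] mm.
- by rewrite /sopp sp; apply: Fp.
- by congr lev: l2; rewrite !big_cons big_nil vec_sopp; ffun_ring.
by rewrite !inE orbb orbb => /eqP ->; rewrite vec_sopp subrK.
Qed.

(** A violation at [p], [r] is compared with [f + vec (true, q)]; each of the three steps between
    them is excluded. *)
Lemma apart_trans q p r : flexible q -> apart p q -> apart q r -> apart p r.
Proof.
move=> Fq pq qr s t sp tr l2.
have [||t'] := @lev_between m e (f + vec (true, q)) [:: s; t; sopp (true, q)] mm.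
- exact: Fq.
- by congr lev: l2; rewrite !big_cons big_nil vec_sopp; ffun_ring.
rewrite !inE => /or3P[] /eqP ->.
- by rewrite addrAC; apply: pq.
- exact: qr.
- by rewrite vec_sopp addrK.
Qed.

(** Adding or dropping the edge turns steps of opposite signs at its ends into two equal steps at
    one end, excluded by [apart_refl]; equal signs reduce to opposite ones by [lev_between]. *)
Lemma apart_edge u v : (0 < m u v)%N -> flexible u -> flexible v -> apart u v.
Proof.
move=> m0 Fu Fv.
have mixed p q : (0 < m p q)%N -> flexible p -> flexible q -> ~ lev m e (f + up p - up q).
  move=> mpq Fp Fq /(lev_edge _ _ mm mpq)[l|l].
    apply: (apart_refl Fp (s := (true, p)) (t := (true, p))) => //.
    by apply/(lev_edge _ _ mm mpq); right; congr lev: l; ffun_ring.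
  apply: (apart_refl Fq (s := sopp (true, q)) (t := sopp (true, q))) => //.
  apply/(lev_edge _ _ mm mpq); left; congr lev: l; rewrite !vec_sopp; ffun_ring.
have mixed' s : s.2 = u -> ~ lev m e (f + vec s + vec (~~ s.1, v)).
  case: s => [[] w] /= ->; first by rewrite (vec_sopp (true, v)); apply: mixed.
  rewrite (vec_sopp (true, u)) addrAC; apply: mixed => //.
  by case: mm => -> _.
move=> s t su tv l2.
have [stE|stE] : t = (s.1, v) \/ t = (~~ s.1, v).
  by case: (s) (t) tv => [[] w] [[] w'] /= ->; [left|right|right|left].
  have [||t'] := @lev_between m e (f + vec (sopp t)) [:: s; t; t] mm.
  - by rewrite /sopp tv; apply: Fv.
  - by congr lev: l2; rewrite !big_cons big_nil vec_sopp; ffun_ring.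
  rewrite !inE orbb => /orP[] /eqP ->.
  - by rewrite addrAC /sopp stE /=; apply: mixed'.
  - by rewrite vec_sopp subrK.
by move: l2; rewrite stE; apply: mixed'.
Qed.
End Apart.
End Levels.

(** * Barriers *)

Lemma ex_minimal (P : nat -> Prop) :
  (exists n, P n) -> exists2 n, P n & forall k, (k < n)%N -> ~ P k.
Proof.
case=> n; elim/ltn_ind: n => n IHn Pn.
have [[k lt_k Pk]|none] := classic (exists2 k, (k < n)%N & P k); first exact: IHn Pk.
by exists n => // k lt_k Pk; case: none; exists k.
Qed.

Lemma uniq_map_pairs (S R : eqType) (h : S -> R) (st : seq S) :
  (forall s t r, perm_eq st [:: s, t & r] -> h s <> h t) -> uniq (map h st).
Proof.
elim: st => //= s st IHst inj; apply/andP; split; last first.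
  apply: IHst => s' t r Er; apply: (inj s' t (s :: r)).
  by apply: perm_trans (_ : perm_eq _ [:: s, s', t & r]) _;
    rewrite ?perm_cons // (perm_catCA [:: s] [:: s'; t] r).
apply/mapP=> -[t st_t]; apply: (inj s t (rem t st)).
by rewrite perm_cons perm_to_rem.
Qed.

Section Components.
Variables (T : finType) (m : T -> T -> nat).
Hypothesis mm : multigraph m.
Implicit Types (S : {set T}) (x y : T).

Lemma adjS_sym S : symmetric (adjS m S).
Proof. by case: mm => mC _ x y; rewrite /adjS mC andbCA. Qed.

Lemma adjS_connect_sym S : connect_sym (adjS m S).
Proof. exact: sym_connect_sym (adjS_sym S). Qed.

Lemma connect_notin S x y : connect (adjS m S) x y -> x \notin S -> y \notin S.
Proof.
move=> /connectP[p]; elim: p x => [|z p IHp] x /=; first by move=> _ ->.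
by move=> /andP[/and3P[_ zS _] pz] ly _; apply: IHp pz ly zS.
Qed.

Lemma root_notin S x : x \notin S -> fingraph.root (adjS m S) x \notin S.
Proof. exact/connect_notin/connect_root. Qed.

Lemma omega_card S : omega m S = #|[set x | roots (adjS m S) x & x \notin S]|.
Proof. by rewrite /omega cardsE; apply: eq_card => x; rewrite !inE. Qed.

Lemma omega_ge S (st : seq T) : (forall x, x \in st -> x \notin S) ->
  uniq (map (fingraph.root (adjS m S)) st) -> (size st <= omega m S)%N.
Proof.
move=> stS ust; rewrite omega_card -(size_map (fingraph.root (adjS m S))) -(card_uniqP ust).
apply/subset_leq_card/subsetP=> _ /mapP[x x_st ->].
by rewrite inE (roots_root (adjS_connect_sym S)) root_notin // stS.
Qed.
End Components.

Section Barrier.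
Variables (T : finType) (m : T -> T -> nat).
Hypothesis mm : multigraph m.
Notation vect := {ffun T -> int}.
Implicit Types (f g : vect) (W A B : {set T}) (s t : bool * T).

(** Deleted vertices stay in the type as isolated ones, where the demand will be 0. *)
Definition restrict W x y : nat := if (x \in W) && (y \in W) then m x y else 0.

Lemma restrict_multigraph W : multigraph (restrict W).
Proof.
case: mm => mC m0; split=> [x y|x]; rewrite /restrict; first by rewrite andbC mC.
by rewrite m0 if_same.
Qed.

Lemma restrict_sub W W' x y : W \subset W' -> (restrict W x y <= restrict W' x y)%N.
Proof.
move=> /subsetP sW; rewrite /restrict.
by case: andP => // -[/sW -> /sW ->].
Qed.

(** Degrees at [s.2] are 0, so the list of steps must contain [sopp s]; dropping it serves [f]. *)
Lemma lev_isolated (m' : T -> T -> nat) d f s : (forall u, m' s.2 u = 0%N) -> f s.2 = 0 ->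
  lev m' d (f + vec s) -> exists2 k, (k < d)%N & lev m' k f.
Proof.
move=> iso f0 [st sz [F [FC Fm] eF]].
have st_s : sopp s \in st.
  apply: along_sum; have d0 : deg F s.2 = 0%N.
    by rewrite /deg big1 // => u _; move: (Fm s.2 u); rewrite iso; lia.
  have := eF s.2; rewrite d0 ffunE [X in X + _]ffunE f0 add0r => e0.
  have : along s (vec s + \sum_(t <- st) vec t) = 0 by rewrite /along ffunE e0 mulr0.
  by rewrite along_sopp alongD along_vv; move: (along _ _) => c; lia.
have dst := perm_to_rem st_s.
exists (size (rem (sopp s) st)); first by rewrite -sz (perm_size dst).
exists (rem (sopp s) st) => //; exists F => // v; rewrite -eF (perm_big _ dst) /=.
by rewrite big_cons vec_sopp; congr fun_of_fin; move: (\sum_(_ <- _) _) => ?; ffun_ring.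
Qed.

(** For [c >= 0] this is [lev_ray]; for [c < 0], walking back to [f] and minimality suffice. *)
Lemma lev_shift (m' : T -> T -> nat) d f s (c : int) j : multigraph m' ->
  (forall k, (k < d.+1)%N -> ~ lev m' k f) -> lev m' d.+1 f ->
  lev m' d (f - vec s) -> ~ lev m' d (f + vec s) ->
  lev m' j (f + vec s *~ c) -> (d.+1)%:Z + c <= j%:Z.
Proof.
move=> mm' fmin lf lfN nlf; case: c => n lj.
  by have := lev_ray mm' fmin lf lfN nlf lj; lia.
have := lev_steps s n.+1 lj; rewrite NegzE mulrNz subrK => lf'.
have [lt_d|] := ltnP (j + n.+1) d.+1; first by case: (fmin _ lt_d lf').
by lia.
Qed.

(** By [flip] and [lev_no_edge] flexibility spreads along edges, so any two vertices in the
    component of a flexible vertex are apart; hence the [d + 1] steps of a shortest list lie in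
    distinct components. *)
Lemma omega_lower_bound W f d : (forall v, v \notin W -> f v = 0) ->
  lev (restrict W) d.+1 f -> (forall k, (k < d.+1)%N -> ~ lev (restrict W) k f) ->
  (forall s, lev (restrict W) d (f + vec s) -> lev (restrict W) d (f + vec (sopp s))) ->
  (d < omega m (~: W))%N.
Proof.
move=> f0 lf fmin flip; have rm := restrict_multigraph W.
have levW s : lev (restrict W) d (f + vec s) -> s.2 \in W.
  move=> ls; apply: contraT => sW.
  have [|k lt_k lk] := lev_isolated _ (f0 _ sW) ls.
    by move=> u; rewrite /restrict (negPf sW).
  by case: (fmin k (ltnW lt_k)).
have flex s b : lev (restrict W) d (f + vec s) -> lev (restrict W) d (f + vec (b, s.2)).
  move=> ls; have [<-//|->] : s = (b, s.2) \/ (b, s.2) = sopp s.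
    by case: s b {ls} => [[] u] []; [left|right|right|left].
  exact: flip.
have [st sz dg] := lf.
have one s : s \in st -> lev (restrict W) d (f + vec s).
  move=> /perm_to_rem E; exists (rem s st).
    by apply: succn_inj; rewrite -sz (perm_size E).
  by move: dg; rewrite (perm_big _ E) big_cons addrA.
rewrite -ltnS -sz -(size_map snd) ltnS; apply: omega_ge => //.
  by move=> _ /mapP[s /one/levW sW ->]; rewrite inE sW.
rewrite -map_comp; apply: uniq_map_pairs => s t r E /=.
move/eqP; rewrite (root_connect (adjS_connect_sym mm _)) => /connectP[p].
have dE : d = (size r).+1 by apply: succn_inj; rewrite -sz (perm_size E).
have ls : lev (restrict W) d (f + vec s) by apply: one; rewrite (perm_mem E) inE eqxx.
(* Together [s] and [t] remove two units, so their vertices are not apart. *)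
have l2 : lev (restrict W) (size r) (f + vec s + vec t).
  by exists r => //; move: dg; rewrite (perm_big _ E) !big_cons !addrA.
have nlf : ~ lev (restrict W) (size r) f by apply: fmin; rewrite dE.
have apart_path q x : (forall b, lev (restrict W) d (f + vec (b, x))) ->
    path (adjS m (~: W)) x q -> apart (restrict W) (size r) f x (last x q).
  elim: q x => [|y q IHq] x Fx /=.
    by move=> _; apply: apart_refl => // b; rewrite -dE; apply: Fx.
  move=> /andP[/and3P[]]; rewrite !inE !negbK => xW yW mxy pq.
  have rxy : (0 < restrict W x y)%N by rewrite /restrict xW yW.
  have Fy b : lev (restrict W) d (f + vec (b, y)).
    apply: NNPP => nb; have nb' : ~ lev (restrict W) d (f + vec (~~ b, y)).
      by move/(@flex (~~ b, y) b).
    apply: (lev_no_edge rm rxy lf (Fx true) (Fx false)).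
      by case: b nb nb'.
    by case: b nb nb'.
  apply: (@apart_trans _ _ _ _ rm nlf y) (IHq y Fy pq).
    by move=> b; rewrite -dE.
  by apply: apart_edge => // b; rewrite -dE.
move=> pp tE; apply: (apart_path p s.2) l2 => //.
by move=> b; apply: flex.
Qed.

Lemma degs_add_vertex W b g : b \in W -> degs (restrict (W :\ b)) g ->
  degs (restrict W)
    [ffun v => g v + (if v == b then \sum_(u in W) (m b u)%:Z else (restrict W v b)%:Z)].
Proof.
move=> bW [F [FC Fm] eF]; have [rC r0] := restrict_multigraph W.
exists (fun x y => if (x == b) || (y == b) then restrict W x y else F x y).
  split=> x y; first by rewrite orbC rC FC.
  by case: ifP => // _; apply: leq_trans (Fm x y) (restrict_sub _ _ (subD1set _ _)).
move=> v; rewrite ffunE /deg.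
have [->|vb] := eqVneq v b.
  rewrite eF /deg big1 => [|u _].
    rewrite add0r /= (big_morph Posz PoszD (erefl _)) big_mkcond /=.
    by apply: eq_bigr => u _; rewrite /restrict bW; case: (u \in W).
  by move: (Fm b u); rewrite /restrict !inE eqxx leqn0 => /eqP.
rewrite eF /deg (bigD1 b) //= [in RHS](bigD1 b) //= eqxx.
have -> : F v b = 0%N.
  by move: (Fm v b); rewrite /restrict !inE eqxx andbF leqn0 => /eqP.
rewrite add0n addnC PoszD; congr (Posz _ + _).
by apply: eq_bigr => u /negPf ->.
Qed.

(* The exact min-max formula counts only the components of odd type; all components are counted
   here, which keeps parities out of the statement. *)
Theorem barrier W f d : (forall v, v \notin W -> f v = 0) ->
  lev (restrict W) d f -> (forall k, (k < d)%N -> ~ lev (restrict W) k f) ->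
  exists A B, [/\ A \subset W, B \subset W, [disjoint A & B] &
    d%:Z + \sum_(a in A) f a + \sum_(b in B) \sum_(u in W :\: A) (m b u)%:Z
      <= (omega m (~: W :|: (A :|: B)))%:Z + \sum_(b in B) f b].
Proof.
have [n] := ubnP #|W|; elim: n W f d => // n IHn W f d; rewrite ltnS => le_n f0 lf fmin.
have trivial_barrier : (d <= omega m (~: W))%N -> exists A B,
   [/\ A \subset W, B \subset W, [disjoint A & B] &
    d%:Z + \sum_(a in A) f a + \sum_(b in B) \sum_(u in W :\: A) (m b u)%:Z
      <= (omega m (~: W :|: (A :|: B)))%:Z + \sum_(b in B) f b].
  move=> le_d; exists set0, set0; rewrite !sub0set !big_set0 !setU0 !addr0.
  by split=> //; rewrite -setI_eq0 setI0.
case: d lf fmin => [|d] lf fmin in trivial_barrier *; first exact: trivial_barrier.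
have rm W' := restrict_multigraph W'.
have [flip|] := classic (forall s, lev (restrict W) d (f + vec s) ->
                              lev (restrict W) d (f + vec (sopp s))).
  by apply/trivial_barrier/(omega_lower_bound f0).
move=> noflip; have [s noflips] := not_all_ex_not _ _ noflip.
have [ls nls] := imply_to_and _ _ noflips; clear noflip noflips.
have sW : s.2 \in W.
  apply: contraT => sW; have [|k lt_k lk] := @lev_isolated _ _ f s _ (f0 _ sW) ls.
    by move=> u; rewrite /restrict (negPf sW).
  by case: (fmin k (ltnW lt_k)).
have ltW : (#|W :\ s.2| < n)%N.
  by move: le_n; rewrite (cardsD1 s.2 W) sW add1n.
(* The distance drops along [s] but not along [sopp s]; so it grows by one with each step along
   [sopp s]. *)
have shift j c : lev (restrict W) j (f + vec (sopp s) *~ c) -> (d.+1)%:Z + c <= j%:Z.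
  by apply: lev_shift => //; rewrite vec_sopp opprK.
case: s => [[] a] /= in ls nls sW ltW shift *.
(* [a] can be raised but not lowered *)
- pose f1 : vect := [ffun v => if v == a then 0 else f v].
  have [d1 l1 min1] := ex_minimal (lev_exists (restrict (W :\ a)) f1).
  have [|A1 [B1 [sA sB dAB ineq]]] := IHn _ f1 d1 ltW _ l1 min1.
    move=> v; rewrite !inE ffunE negb_and negbK; case: eqP => //= _; exact: f0.
  (* The demand at [a] moves to 0 by [f a] lowering steps, and deleting [a] creates no new
     subgraphs. *)
  have dd1 : (d.+1)%:Z + f a <= d1%:Z.
    apply: shift; have -> : f + vec (sopp (true, a)) *~ f a = f1.
      apply/ffunP=> v; rewrite ffunE ffunMzE !ffunE /=.
      by case: eqP => [->|_]; rewrite ?mul0rz ?addr0 // mulrzz; ring.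
    by apply: lev_mono l1 => x y; apply/restrict_sub/subD1set.
  have aA : a \notin A1 by apply/negP=> /(subsetP sA); rewrite !inE eqxx.
  have aB : a \notin B1 by apply/negP=> /(subsetP sB); rewrite !inE eqxx.
  have f1E (C : {set T}) : a \notin C -> \sum_(v in C) f1 v = \sum_(v in C) f v.
    move=> aC; apply: eq_bigr => v vC; rewrite ffunE; case: eqP => // va.
    by rewrite -va vC in aC.
  exists (a |: A1), B1; split.
  + by rewrite subUset sub1set sW (subset_trans sA) ?subD1set.
  + by rewrite (subset_trans sB) ?subD1set.
  + by rewrite -setI_eq0 setIUl setU_eq0 !setI_eq0 disjoints1 aB.
  have WE : W :\: (a |: A1) = (W :\ a) :\: A1 by rewrite setDDl.
  have SE : ~: W :|: (a |: A1 :|: B1) = ~: (W :\ a) :|: (A1 :|: B1).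
    by rewrite setCD -!setUA.
  rewrite WE SE big_setU1 //=; move: ineq; rewrite !f1E //.
  move: (\sum_(v in A1) f v) (\sum_(v in B1) f v) (\sum_(b in B1) _) (omega _ _) => p q r w.
  by lia.
(* [a] can be lowered but not raised: all edges at [a] are put into the subgraph *)
pose f1 : vect := [ffun v => if v \in W :\ a then f v - (m v a)%:Z else 0].
have [d1 l1 min1] := ex_minimal (lev_exists (restrict (W :\ a)) f1).
have [|A1 [B1 [sA sB dAB ineq]]] := IHn _ f1 d1 ltW _ l1 min1.
  by move=> v /negPf vW; rewrite ffunE vW.
have aA : a \notin A1 by apply/negP=> /(subsetP sA); rewrite !inE eqxx.
have aB : a \notin B1 by apply/negP=> /(subsetP sB); rewrite !inE eqxx.
pose D : int := \sum_(u in W) (m a u)%:Z.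
(* With all edges at [a] added, a list of steps for [f1] serves [f] with its value at [a] changed to
   [D]. *)
have dd1 : (d.+1)%:Z + (D - f a) <= d1%:Z.
  apply: shift; case: l1 => st sz dst; exists st => //.
  congr degs: (degs_add_vertex sW dst); apply/ffunP=> v.
  rewrite !(ffunE, ffunMzE) /= /restrict sW andbT !inE.
  move: ((\sum_(s <- st) vec s : vect) v) => c; have [->|va] := eqVneq v a.
    by rewrite /= -/D mulrzz; ring.
  by case: (boolP (v \in W)) => [_|/f0 ->] /=; rewrite mul0rz; ring.
exists A1, (a |: B1); split.
- by rewrite (subset_trans sA) ?subD1set.
- by rewrite subUset sub1set sW (subset_trans sB) ?subD1set.
- by rewrite -setI_eq0 setIUr setU_eq0 !setI_eq0 disjoint_sym disjoints1 aA.
have WE : a |: (W :\ a) :\: A1 = W :\: A1.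
  by apply/setP=> v; rewrite !inE; case: eqP => // ->; rewrite aA sW.
have SE : ~: W :|: (A1 :|: (a |: B1)) = ~: (W :\ a) :|: (A1 :|: B1).
  by rewrite setCD -setUA (setUCA A1).
have aWA : a \notin (W :\ a) :\: A1 by rewrite !inE eqxx andbF.
have f1E (C : {set T}) : C \subset W :\ a ->
    \sum_(v in C) f1 v = \sum_(v in C) f v - \sum_(v in C) (m a v)%:Z.
  move=> /subsetP sC; rewrite -sumrB; apply: eq_bigr => v /sC vW.
  by rewrite ffunE vW; case: mm => ->.
(* Edges from [a] to [A1] are counted in [D] and deducted in [f1], so they cancel; those to [B1]
   complete the degrees in [W :\: A1]. *)
have DE : D = \sum_(v in A1) (m a v)%:Z + \sum_(v in W :\: A1) (m a v)%:Z.
  rewrite /D (big_setID A1) /=; congr (_ + _); apply: eq_bigl => v.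
  by rewrite in_setI andb_idl // => /(subsetP sA); rewrite inE => /andP[].
have BE : \sum_(b in B1) \sum_(u in W :\: A1) (m b u)%:Z =
    \sum_(b in B1) (m a b)%:Z + \sum_(b in B1) \sum_(u in (W :\ a) :\: A1) (m b u)%:Z.
  rewrite -big_split /=; apply: eq_bigr => b _.
  by rewrite -WE big_setU1 //=; case: mm => ->.
rewrite SE !big_setU1 //= BE; move: ineq dd1; rewrite !f1E // DE.
move: (\sum_(v in A1) f v) (\sum_(v in B1) f v) (omega _ _) => p q w.
move: (\sum_(v in A1) (m a v)%:Z) (\sum_(v in B1) (m a v)%:Z) => p' q'.
by move: (\sum_(v in W :\: A1) _) (\sum_(b in B1) _) (f a) => p'' q'' fa; lia.
Qed.
End Barrier.

(** * From barriers to near factors *)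

Lemma degs_raise_lacking (T : finType) (m : T -> T -> nat) (g : {ffun T -> int}) (b : T) :
  multigraph m -> degs m g -> g b < (deg m b)%:Z ->
  exists u, degs m (g + vec (true, b) + vec (true, u)).
Proof.
move=> mm [F [FC Fm] eF]; rewrite eF ltz_nat => lt_b; have [mC _] := mm.
have [u lt_u] : exists u, (F b u < m b u)%N.
  apply/existsP; apply: contraTT lt_b; rewrite negb_exists -leqNgt => /forallP le_F.
  by apply: leq_sum => u _; rewrite leqNgt le_F.
have bu := multigraph_neq mm (leq_ltn_trans (leq0n _) lt_u).
exists u, (plus_edge F b u).
  split=> x y; first by rewrite /plus_edge FC edgeC.
  rewrite /plus_edge; case: (edge_cases b u x y) => [->|[-> E]]; first by rewrite addn0.
  by rewrite !E // addn1.
by move=> w; rewrite deg_plus_edge // !ffunE eF /=; case: eqP; case: eqP; lia.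
Qed.

Theorem near_factor_of_barriers (T : finType) (m : T -> T -> nat) (f : T -> nat) :
  multigraph m -> (forall v, f v <= deg m v)%N ->
  (forall A B : {set T}, [disjoint A & B] ->
    (omega m (A :|: B) + \sum_(b in B) f b <=
     \sum_(a in A) f a + \sum_(b in B) \sum_(u in ~: A) m b u + 1)%N) ->
  near_factor m f.
Proof.
move=> mm le_f noB; pose g : {ffun T -> int} := [ffun v => (f v)%:Z].
have near0 : degs m g -> near_factor m f.
  move=> [F sF eF]; exists F; split=> //; exists set0; first by rewrite cards0.
  by move=> v; rewrite inE; move: (eF v); rewrite ffunE => -[].
have near1 u : degs m (g + vec (true, u)) -> near_factor m f.
  move=> [F sF eF]; exists F; split=> //; exists [set u]; first by rewrite cards1.
  by move=> v; rewrite inE; move: (eF v); rewrite !ffunE /=; case: ifP => _; lia.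
have rT x y : restrict m setT x y = m x y by rewrite /restrict !inE.
have toT k h : lev m k h -> lev (restrict m setT) k h.
  by apply: lev_mono => x y; rewrite rT.
have ofT k h : lev (restrict m setT) k h -> lev m k h.
  by apply: lev_mono => x y; rewrite rT.
have [[|[|d]] /ofT ld min_d] := ex_minimal (lev_exists (restrict m setT) g).
- exact/near0/lev0.
- move/levS: ld => [[[] b] /lev0 dg]; first exact: near1 dg.
  have [|u] := degs_raise_lacking (b := b) mm dg.
    by rewrite !ffunE eqxx /=; move: (le_f b); lia.
  by rewrite (vec_sopp (true, b)) subrK; apply: near1.
have [|A [B [_ _ dAB]]] := barrier mm _ (toT _ _ ld) min_d.
  by move=> v; rewrite inE.
rewrite setCT set0U setTD.
have := noB A B dAB; rewrite -lez_nat !PoszD.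
have E (C : {set T}) (F : T -> nat) : (\sum_(v in C) F v)%N%:Z = \sum_(v in C) (F v)%:Z.
  exact: (big_morph Posz PoszD (erefl _)).
have gE (C : {set T}) : \sum_(v in C) g v = \sum_(v in C) (f v)%:Z.
  by apply: eq_bigr => v _; rewrite ffunE.
rewrite !E !gE; under [X in _ + X + _]eq_bigr => b _ do rewrite E.
move=> h1 h2; exfalso; move: h1 h2.
move: (omega _ _) (\sum_(v in A) _) (\sum_(v in B) (f v)%:Z) => w p q.
by move: (\sum_(b in B) _) => r; lia.
Qed.

(** * Deleting vertices so as to isolate stars *)

Local Open Scope nat_scope.

(** Pick a vertex of maximal key, discard its neighbours, and repeat. *)
Lemma greedy_independent (T : finType) (e : rel T) (key : T -> int) (B : {set T}) :
  symmetric e -> irreflexive e ->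
  exists I : {set T}, [/\ I \subset B, {in I &, forall i j, ~~ e i j} &
    forall u, u \in B :\: I -> exists2 i, i \in I & e i u && (key u <= key i)%R].
Proof.
move=> eC e0; have [n] := ubnP #|B|; elim: n B => // n IHn B; rewrite ltnS => le_n.
have [->|[v0 v0B]] := set_0Vmem B.
  by exists set0; split=> [|i j|u]; rewrite ?sub0set ?inE // andbF.
case: (arg_maxP key v0B) => v vB vmax.
have {}vmax u : u \in B -> (key u <= key v)%R by exact: vmax.
pose B1 := [set u in B | (u != v) && ~~ e v u].
have [|I1 [sI1 ind1 dom1]] := IHn B1.
  apply: leq_trans le_n; apply: proper_card; apply/properP; split.
    by apply/subsetP=> u; rewrite inE => /andP[].
  by exists v => //; rewrite inE eqxx andbF.
have v1 i : i \in I1 -> ~~ e v i by move=> /(subsetP sI1); rewrite inE => /and3P[].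
exists (v |: I1); split.
- rewrite subUset sub1set [v \in B]vB; apply/subsetP=> u /(subsetP sI1).
  by rewrite inE => /andP[].
- move=> i j /setU1P[->|iI] /setU1P[->|jI]; rewrite ?e0 //; first exact: v1.
    by rewrite eC v1.
  exact: ind1.
move=> u; rewrite !inE negb_or => /andP[/andP[uv uI] uB].
have [evu|nevu] := boolP (e v u).
  by exists v; rewrite ?setU11 // evu vmax.
have [|i iI ei] := dom1 u; first by rewrite !inE uI uB uv.
by exists i; rewrite // setU1r.
Qed.

Section StarChoice.
Variables (T : finType) (m : T -> T -> nat).
Hypothesis mm : multigraph m.

(** The condition on stars speaks of complete choices, while only some centers will be prescribed;
    missing components are added one at a time. *)
Lemma star_choice_extend (S I0 : {set T}) :
  (forall x, x \in I0 -> starCenter m S x) ->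
  (forall x y, x \in I0 -> y \in I0 -> sameComp m S x y -> x = y) ->
  exists2 I : {set T}, I0 \subset I & starCenterChoice m S I.
Proof.
have [n] := ubnP #|~: I0|; elim: n I0 => // n IHn I0; rewrite ltnS => le_n sc0 inj0.
have [[c [scc nc]]|none] := classic (exists c, starCenter m S c /\
    forall x, x \in I0 -> ~~ sameComp m S x c); last first.
  exists I0 => //; split; first exact: sc0.
  split; first exact: inj0.
  move=> c scc; apply: NNPP => noc; case: none; exists c; split=> // x xI.
  by apply/negP=> xc; case: noc; exists x.
have cI0 : c \notin I0 by apply/negP=> /nc; rewrite /sameComp connect0.
have [|||I sI chI] := IHn (c |: I0).
- apply: leq_trans le_n; apply: proper_card; rewrite properC.
  by rewrite properE subsetUr /= subUset sub1set (negPf cI0).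
- by move=> x /setU1P[->|/sc0].
- move=> x y /setU1P[->|xI] /setU1P[->|yI] //; last exact: inj0.
    by rewrite /sameComp adjS_connect_sym // => h; case/negP: (nc y yI).
  by move=> h; case/negP: (nc x xI).
by exists I => //; apply: subset_trans sI; apply: subsetUr.
Qed.

Lemma isolated_in_choice (S I : {set T}) : starCenterChoice m S I ->
  isoSet m S \subset I.
Proof.
move=> [_ [_ cover]]; apply/subsetP=> v; rewrite inE => /andP[vS /forallP isov].
have comp1 x : sameComp m S v x -> x = v.
  move=> /connectP[[|y p] /=]; first by [].
  move=> /andP[/and3P[_ yS mvy] _] _.
  by move: (isov y); rewrite yS => /eqP mvy0; rewrite mvy0 in mvy.
have [|x xI] := cover v.
  by split=> //; split=> [x xv _ /comp1|x y xv _ _ _ /comp1] xE; rewrite xE eqxx in xv.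
by rewrite /sameComp adjS_connect_sym // => /comp1 <-.
Qed.
End StarChoice.

Section StarDeletion.
Variables (T : finType) (m : T -> T -> nat) (A B I : {set T}).
Hypotheses (mm : multigraph m) (dAB : [disjoint A & B]) (sIB : I \subset B).
Hypothesis indI : forall i j, i \in I -> j \in I -> m i j = 0.

Notation S0 := (A :|: B).
Notation e0 := (adjS m S0).
Notation root0 := (fingraph.root e0).

Definition edgesI w := \sum_(i in I) m w i.
Definition full c := [forall w, connect e0 c w ==> (0 < edgesI w)].
(* When all vertices of a component have neighbours in [I], deleting them would lose the component;
   its root is kept instead if it can become a leaf of a star centered in [I]. *)
Definition leaf w := [&& w \notin S0, root0 w == w, full w & edgesI w == 1].
Definition removed := [set w | [&& w \notin S0, 0 < edgesI w & ~~ leaf w]].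
Definition starDel := A :|: (B :\: I) :|: removed.

Let mC x y : m x y = m y x. Proof. by case: mm. Qed.

Lemma I_notin_A i : i \in I -> i \notin A.
Proof. by move=> /(subsetP sIB) iB; rewrite (disjointFl dAB). Qed.

Lemma I_in_S0 i : i \in I -> i \in S0.
Proof. by move=> /(subsetP sIB) iB; rewrite inE iB orbT. Qed.

Lemma notin_starDel x :
  (x \notin starDel) = (x \in I) || (x \notin S0) && ((edgesI x == 0) || leaf x).
Proof.
rewrite /starDel in_setU; have -> : (x \in removed) = [&& x \notin S0, 0 < edgesI x & ~~ leaf x] by rewrite in_set.
rewrite /starDel lt0n; case: (leaf x) (edgesI x == 0) => [] []; rewrite !inE.
all: have [xI|xI] := boolP (x \in I); rewrite ?(negPf (I_notin_A xI)) ?(subsetP sIB _ xI) //=.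
all: by case: (x \in A); case: (x \in B).
Qed.

Lemma edgesI_gt0 w i : i \in I -> 0 < m w i -> 0 < edgesI w.
Proof. by move=> iI; rewrite /edgesI (bigD1 i) //=; lia. Qed.

Lemma leaf_edge w i : i \in I -> leaf w -> 0 < m w i ->
  m w i = 1 /\ forall j, j \in I -> 0 < m w j -> j = i.
Proof.
move=> iI /and4P[_ _ _ /eqP]; rewrite /edgesI (bigD1 i) //= => e1 m0.
split=> [|j jI mj]; first by lia.
apply/eqP; apply: contraT => ji; move: e1.
by rewrite (bigD1 j) ?jI //=; lia.
Qed.

Lemma adj_I x y : x \in I -> adjS m starDel x y -> leaf y.
Proof.
move=> xI /and3P[_]; rewrite notin_starDel => /orP[yI|/andP[_ /orP[/eqP y0|//]]] mxy.
  by rewrite indI in mxy.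
by have := edgesI_gt0 xI (_ : 0 < m y x); rewrite y0 mC => /(_ mxy).
Qed.

(** A neighbour outside [I] would lie in the same full component, hence survive only as its root,
    which is the leaf itself. *)
Lemma adj_leaf x y : leaf x -> adjS m starDel x y -> y \in I.
Proof.
move=> lx /and3P[_]; rewrite notin_starDel => /orP[//|/andP[yS hy]] mxy.
have /and4P[xS /eqP rx /forallP fx _] := lx.
have cxy : connect e0 x y by apply: connect1; rewrite /adjS xS yS.
have /orP[/eqP y0|/and4P[_ /eqP ry _ _]] := hy.
  by have := fx y; rewrite cxy y0.
have : root0 x = root0 y by apply/(fingraph.rootP (adjS_connect_sym mm _)).
by rewrite rx ry => xy; move: mxy; rewrite xy; case: mm => _ ->.
Qed.

Lemma connect_I i x : i \in I -> connect (adjS m starDel) i x ->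
  x = i \/ leaf x /\ 0 < m i x.
Proof.
move=> iI /connectP[p]; elim/last_ind: p x => [|p z IHp] x /=; first by move=> _ ->; left.
rewrite rcons_path last_rcons => /andP[/IHp IH lz] ->.
have [lE|[ll ml]] := IH _ erefl.
  rewrite lE in lz; right; split; first exact: adj_I lz.
  by case/and3P: lz.
rewrite mC in ml; left; apply: (leaf_edge iI ll ml).2; first exact: adj_leaf lz.
by case/and3P: lz.
Qed.

Lemma I_notin_starDel i : i \in I -> i \notin starDel.
Proof. by rewrite notin_starDel => ->. Qed.

Lemma leaf_notin_I x : leaf x -> x \notin I.
Proof. by case/and4P=> xS _ _ _; apply: contraNN xS; apply: I_in_S0. Qed.

Lemma I_starCenter i : i \in I -> starCenter m starDel i.
Proof.
move=> iI; split; first exact: I_notin_starDel.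
split=> [x xi _ /(connect_I iI)|x y xi yi xS yS /(connect_I iI) + /(connect_I iI)].
  case=> [xE|[lx mx]]; first by rewrite xE eqxx in xi.
  by rewrite mC in mx *; case: (leaf_edge iI lx mx).
case=> [xE|[lx mx]]; first by rewrite xE eqxx in xi.
case=> [yE|[ly my]]; first by rewrite yE eqxx in yi.
apply/eqP; rewrite -leqn0 leqNgt; apply/negP => mxy.
by have := adj_leaf lx (_ : adjS m starDel x y); rewrite /adjS xS yS (negPf (leaf_notin_I ly)) => /(_ mxy).
Qed.

Lemma I_separated i j : i \in I -> j \in I -> sameComp m starDel i j -> i = j.
Proof.
move=> iI jI /(connect_I iI)[->//|[lj _]].
by have := leaf_notin_I lj; rewrite jI.
Qed.

(** Surviving vertices outside [I] with neighbours in [I] are leaves, and leaves are adjacent to [I]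
    only, so a path never reaches them. *)
Lemma connect_away x y : x \notin S0 -> edgesI x = 0 -> connect (adjS m starDel) x y ->
  [/\ y \notin S0, edgesI y = 0 & connect e0 x y].
Proof.
move=> xS x0 /connectP[p]; elim/last_ind: p y => [|p z IHp] y /=.
  by move=> _ ->; rewrite connect0.
rewrite rcons_path last_rcons => /andP[/IHp IH lz] ->.
have [lS l0 cl] := IH _ erefl; set l := last x p in lS l0 cl lz.
have lI : l \notin I by apply: contraNN lS; apply: I_in_S0.
have zl : adjS m starDel z l by rewrite adjS_sym.
have /and3P[_ zS1 mlz] := lz; move: zS1; rewrite notin_starDel.
case/orP=> [zI|/andP[zS /orP[/eqP z0|lfz]]].
- by have := edgesI_gt0 zI mlz; rewrite l0.
- by split=> //; apply: connect_trans cl (connect1 _); rewrite /adjS lS zS.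
- by rewrite (adj_leaf lfz zl) in lI.
Qed.

Definition nonfull_roots := [set c in [set c | roots e0 c & c \notin S0] | ~~ full c].
Definition full_roots := [set c in [set c | roots e0 c & c \notin S0] | full c].

Lemma omega_full : omega m S0 = #|full_roots| + #|nonfull_roots|.
Proof.
rewrite omega_card -(cardsID [set c | full c]); congr (_ + _); apply: eq_card => c;
  by rewrite !inE andbC.
Qed.

(** Each nonfull component keeps a vertex without neighbours in [I]; by [connect_away] these are
    separated from [I] and from one another. *)
Lemma omega_starDel : #|I| + #|nonfull_roots| <= omega m starDel.
Proof.
pose z c := odflt c [pick w | connect e0 c w & edgesI w == 0].
have zP c : c \in nonfull_roots ->
    [/\ roots e0 c, connect e0 c (z c), z c \notin S0 & edgesI (z c) = 0].
  rewrite !inE => /andP[/andP[rc cS]]; rewrite negb_forall => /existsP[w].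
  rewrite negb_imply -leqNgt leqn0 => /andP[cw w0]; rewrite /z.
  case: pickP => [y /andP[cy /eqP y0] /=|/(_ w)]; last by rewrite cw w0.
  by split=> //; have := connect_notin cy; rewrite !inE; apply.
have symD := adjS_connect_sym mm starDel.
have -> : #|I| + #|nonfull_roots| = size (enum I ++ [seq z c | c <- enum nonfull_roots]).
  by rewrite size_cat size_map -!cardE.
apply: omega_ge => // [x|].
  rewrite mem_cat mem_enum => /orP[/I_notin_starDel//|/mapP[c]].
  by rewrite mem_enum => /zP[_ _ zS z0] ->; rewrite notin_starDel zS z0 orbT.
rewrite map_cat cat_uniq -map_comp; apply/and3P; split.
- rewrite map_inj_in_uniq ?enum_uniq // => i j; rewrite !mem_enum => iI jI.
  by move/(fingraph.rootP symD); apply: I_separated.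
- apply/hasPn=> x /mapP[c]; rewrite mem_enum => /zP[_ _ zS z0] ->{x}.
  apply/mapP=> -[i]; rewrite mem_enum => iI /(fingraph.rootP symD) /(connect_away zS z0)[].
  by rewrite I_in_S0.
- rewrite map_inj_in_uniq ?enum_uniq // => c c'; rewrite !mem_enum.
  move=> /zP[rc cz zS z0] /zP[rc' cz' _ _] /(fingraph.rootP symD) /(connect_away zS z0)[_ _ czz'].
  rewrite -(eqP rc) -(eqP rc'); apply/(fingraph.rootP (adjS_connect_sym mm _)).
  apply: connect_trans cz (connect_trans czz' _).
  by rewrite adjS_connect_sym.
Qed.

(** A vertex counts twice on the left only if it is the root of a full component but no leaf, and
    then it has at least two edges to [I]. *)
Lemma card_removed : #|removed| + #|full_roots| <= \sum_(w in ~: S0) edgesI w.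
Proof.
have cE (P : {set T}) : P \subset ~: S0 -> #|P| = \sum_(w in ~: S0) (w \in P).
  move=> sP; rewrite -sum1_card [in RHS](big_setID P) /= [X in _ + X]big1 ?addn0.
    by rewrite (setIidPr sP); apply: eq_bigr => w ->.
  by move=> w; rewrite inE => /andP[/negPf ->].
have sR : removed \subset ~: S0.
  by apply/subsetP=> w; rewrite in_setC in_set => /and3P[].
have sF : full_roots \subset ~: S0.
  by apply/subsetP=> w; rewrite in_setC !in_set => /andP[/andP[]].
rewrite (cE _ sR) (cE _ sF) -big_split /=; apply: leq_sum => w; rewrite in_setC => wS.
have -> : (w \in removed) = (0 < edgesI w) && ~~ leaf w by rewrite in_set wS.
have -> : (w \in full_roots) = (root0 w == w) && full w by rewrite 2!in_set wS andbT.
rewrite /leaf wS /=; have [/andP[-> fw]|nfw] := boolP ((root0 w == w) && full w).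
  have := forallP fw w; rewrite connect0 fw /=.
  by case: (edgesI w) => [|[|k]].
by rewrite addn0; case: (edgesI w) => // k; case: (~~ _).
Qed.

Hypothesis domI : forall u, u \in B :\: I -> exists2 i, i \in I & 0 < m i u.

(** Thus the condition on stars pays for the terms in [h]. An isolated [w] outside [I] has no
    neighbour in [I], as [I] is not deleted, so [domI] keeps it out of [B]. A neighbour surviving in
    [G - starDel] would have none in [I] either, yet be deleted as a neighbour of [J]. *)
Lemma isolated_sub (J : {set T}) : J \subset I ->
  isoSet m (A :|: [set u | (u \notin A) && [exists i in J, 0 < m i u]])
    \subset I :|: isoSet m starDel.
Proof.
move=> sJI; set S2 := _ :|: _; apply/subsetP=> w.
rewrite inE => /andP[wS2 /forallP isow].
have iso u : 0 < m w u -> u \in S2.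
  by move=> mwu; apply: contraLR mwu => uS2; have := isow u; rewrite uS2 => /eqP ->.
have wA : w \notin A by apply: contraNN wS2 => wA; rewrite inE wA.
have noI : forall i, i \in I -> m w i = 0.
  move=> i iI; apply/eqP; rewrite -leqn0 leqNgt; apply/negP=> /iso.
  rewrite !inE (negPf (I_notin_A iI)) /= => /existsP[j /andP[/(subsetP sJI) jI]].
  by rewrite indI.
rewrite in_setU; have [//|wI] := boolP (w \in I).
have wS0 : w \notin S0.
  rewrite inE (negPf wA) /=; apply/negP=> wB; have [|i iI] := domI (u := w).
    by rewrite inE wI.
  by rewrite mC noI.
have w0 : edgesI w = 0 by rewrite /edgesI big1.
have wS1 : w \notin starDel by rewrite notin_starDel wS0 w0 orbT.
rewrite inE wS1; apply/forallP=> u; apply/implyP=> uS1.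
rewrite -leqn0 leqNgt; apply/negP=> mwu.
have [uS0 u0 _] : [/\ u \notin S0, edgesI u = 0 & connect e0 w u].
  by apply: connect_away => //; apply: connect1; rewrite /adjS wS1 uS1.
have := iso u mwu; rewrite !inE; move: uS0; rewrite inE negb_or => /andP[/negPf -> _] /=.
move=> /existsP[i /andP[/(subsetP sJI) iI]]; rewrite mC => miu.
by have := edgesI_gt0 iI miu; rewrite u0.
Qed.
End StarDeletion.

(** * Toughness excludes barriers *)

Local Open Scope ring_scope.

(** If [a] is an integer of the same parity as [n], the square is that of an odd integer. It is the
    gap between [(n + a - 1)^2] and [4 x (n + a - 1 - x)]. *)
Lemma eps0_le_sqr (R : archiRealFieldType) (a : R) (n x : nat) :
  eps0 a n <= (n%:R + a - 1 - 2 * x%:R) ^+ 2.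
Proof.
rewrite /eps0; case: ifP => [/andP[aZ ev]|_]; last exact: sqr_ge0.
have {aZ} aE : a = (Num.floor a)%:~R by apply/eqP; rewrite eq_sym -intrEfloor.
move: (Num.floor a) aE ev => k -> ev.
have -> : n%:R + k%:~R - 1 - 2 * x%:R = (n%:Z + k - 1 - 2 * x%:Z)%:~R :> R.
  by rewrite !(intrB, intrD, intrM).
have : n%:Z + k - 1 - 2 * x%:Z != 0 by lia.
move: (_ - _) => y y0; rewrite -rmorphXn /= ler1z; nia.
Qed.

Lemma eps0_le1 (R : archiRealFieldType) (a : R) n : eps0 a n <= 1.
Proof. by rewrite /eps0; case: ifP. Qed.

Lemma tfun_scaled (R : archiRealFieldType) (T : finType) (f : T -> nat) (a : R) h (v : T) :
  1 < a -> (a - 1) * tfun f a h v = (((f v)%:R + a - 1) ^+ 2 - eps0 a (f v)) / 4 - h v.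
Proof. by move=> a1; rewrite /tfun; field; lra. Qed.

(** Replace [p + e] by its bound [x]; then [p * (f - x)] is compared with [x * (f - x)] or 0,
    according to the sign of [f - x]. *)
Lemma component_charge (f x p e : int) : 0 <= p -> 0 <= e -> p + e <= x ->
  (1 + p) * (f - x) + p + e <= (if x <= f then x * (f - x) else 0) + f.
Proof. by move=> p0 e0 pe; case: ifP => h; nia. Qed.

(** * Charging [B] to the independent set *)

Section Counting.
Variables (T : finType) (m : T -> T -> nat) (A B : {set T}) (f : T -> nat).
Definition degOut v : nat := \sum_(u in ~: A) m v u.

Lemma card_outer_nbrs (J : {set T}) :
  (#|A :|: [set u | (u \notin A) && [exists i in J, (0 < m i u)%N]]|
     <= #|A| + \sum_(i in J) degOut i)%N.
Proof.
apply: leq_trans (leq_card_setU _ _) _; rewrite leq_add2l /degOut exchange_big /=.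
rewrite -sum1_card big_mkcond [in X in (_ <= X)%N]big_mkcond /=; apply: leq_sum => u _.
rewrite !inE; case: (u \in A) => //=; case: existsP => // -[i /andP[iJ mi]].
by rewrite (bigD1 i) //=; lia.
Qed.

Hypotheses (mm : multigraph m) (dAB : [disjoint A & B]).
Let mC x y : m x y = m y x. Proof. by case: mm. Qed.

(** Each vertex of [B :\: I] is charged to a neighbour in [I] with at least its key;
    [component_charge] bounds what each [i] receives. *)
Lemma greedy_charge : exists I : {set T}, [/\ I \subset B,
  forall i j, i \in I -> j \in I -> m i j = 0%N,
  forall u, u \in B :\: I -> exists2 i, i \in I & (0 < m i u)%N &
  \sum_(b in B) ((f b)%:Z - (degOut b)%:Z) + #|B :\: I|%:Z +
     (\sum_(w in ~: (A :|: B)) edgesI m I w)%N%:Z <=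
  \sum_(i in I | (degOut i <= f i)%N) (degOut i)%:Z * ((f i)%:Z - (degOut i)%:Z)
    + \sum_(i in I) (f i)%:Z].
Proof.
pose key u : int := (f u)%:Z - (degOut u)%:Z.
have [||I [sIB ind dom]] := @greedy_independent T (fun i u => 0 < m i u)%N key B.
- by move=> i u; rewrite mC.
- by move=> i; case: mm => _ ->.
have indI i j : i \in I -> j \in I -> m i j = 0%N.
  by move=> iI jI; have := ind i j iI jI; lia.
exists I; split=> //.
  by move=> u /dom[i iI /andP[mi _]]; exists i.
pose pi u := odflt u [pick i in I | (0 < m i u)%N && (key u <= key i)].
have piP u : u \in B :\: I -> [/\ pi u \in I, (0 < m (pi u) u)%N & key u <= key (pi u)].
  move=> /dom[i iI ei]; rewrite /pi; case: pickP => [j /and3P[] //|/(_ i)].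
  by rewrite /= iI ei.
pose p i := #|[set u in B :\: I | pi u == i]|.
pose e i := (\sum_(w in ~: (A :|: B)) m i w)%N.
(* Both are parts of the degree outside [A]: [p i] within [B], [e i] outside [B]. *)
have pe i : i \in I -> (p i + e i <= degOut i)%N.
  move=> iI; rewrite /degOut (big_setID B) /= leq_add //.
    rewrite /p -sum1_card big_mkcond [in X in (_ <= X)%N]big_mkcond /=.
    apply: leq_sum => u _; rewrite inE; case: andP => // -[uB /eqP <-].
    have [_ mu _] := piP _ uB; move: uB; rewrite !inE => /andP[_ uB].
    by rewrite uB (disjointFl dAB).
  rewrite /e (_ : ~: A :\: B = ~: (A :|: B)) //.
  by apply/setP=> u; rewrite !inE negb_or andbC.
have eE : (\sum_(w in ~: (A :|: B)) edgesI m I w)%N = (\sum_(i in I) e i)%N.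
  rewrite /edgesI exchange_big; apply: eq_bigr => i _; apply: eq_bigr => w _.
  exact: mC.
have partI (F : T -> int) : \sum_(u in B :\: I) F (pi u) = \sum_(i in I) F i * (p i)%:Z.
  rewrite (partition_big pi (mem I)) /=; last by move=> u /piP[].
  apply: eq_bigr => i _; rewrite (eq_bigr (fun=> F i)); last by move=> u /andP[_ /eqP ->].
  rewrite -big_filter big_const_seq count_predT iter_addr_0 -mulr_natr natz; congr (_ * _%:Z).
  by rewrite size_filter /p -sum1_card -sum1_count; apply: eq_bigl => u; rewrite !inE.
have cE : #|B :\: I|%:Z = \sum_(i in I) (p i)%:Z.
  rewrite -sum1_card (big_morph Posz PoszD (erefl _)) (partI (fun=> 1)).
  by apply: eq_bigr => i _; rewrite mul1r.
rewrite eE (big_morph Posz PoszD (erefl _)) cE (big_setID I) /= (setIidPr sIB).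
apply: (@le_trans _ _ (\sum_(i in I) ((1 + (p i)%:Z) * key i + (p i)%:Z + (e i)%:Z))).
  rewrite [X in _ <= X]big_split [X in _ <= X + _]big_split /= !lerD2r.
  have -> : \sum_(i in I) (1 + (p i)%:Z) * key i =
      \sum_(i in I) key i + \sum_(i in I) key i * (p i)%:Z.
    by rewrite -big_split; apply: eq_bigr => i _ /=; ring.
  by rewrite lerD2l -partI; apply: ler_sum => u /piP[].
rewrite big_mkcondr /= -big_split /=; apply: ler_sum => i iI.
have := @component_charge (f i)%:Z (degOut i)%:Z (p i)%:Z (e i)%:Z isT isT.
by rewrite -PoszD !lez_nat; apply; apply: pe.
Qed.
End Counting.

Section Toughness.
Variables (R : archiRealFieldType) (T : finType) (m : T -> T -> nat).
Variables (f : T -> nat) (a : R) (h : T -> R).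
Hypotheses (mm : multigraph m) (f_gt0 : forall v, (0 < f v)%N).
Hypotheses (a_gt1 : 1 < a) (a_le_f : forall v, a <= (f v)%:R) (h_ge0 : forall v, 0 <= h v).
Hypothesis iso_tough_t : iso_tough m (tfun f a h).
Hypothesis star_tough : forall S I : {set T}, starCenterChoice m S I ->
  \sum_(v in I) ((f v)%:R + h v - 1) + (omega m S)%:R <= (#|S|)%:R + 1.

Let natR (C : {set T}) (F : T -> nat) : (\sum_(v in C) F v)%N%:R = \sum_(v in C) (F v)%:R :> R.
Proof. exact: (big_morph _ (natrD _) (erefl _)). Qed.

(** By [eps0_le_sqr] each summand on the left is at most [(a - 1) * t + h], which is nonnegative
    also outside [J]. *)
Lemma iso_tough_charge (S J : {set T}) (x : T -> nat) : J \subset isoSet m S ->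
  \sum_(i in J) ((x i)%:R * ((f i)%:R - (x i)%:R) + (a - 1) * (x i)%:R)
    <= (a - 1) * #|S|%:R + \sum_(v in isoSet m S) h v.
Proof.
move=> sJ; have a1 : 0 < a - 1 by rewrite subr_gt0.
pose q v : R := (((f v)%:R + a - 1) ^+ 2 - eps0 a (f v)) / 4.
have q_ge0 v : 0 <= q v.
  have := eps0_le1 a (f v); have := a_le_f v => fa e1.
  by rewrite divr_ge0 // subr_ge0 (le_trans e1) // expr_ge1 //; lra.
have := iso_tough_t S; rewrite -(ler_pM2l a1) mulr_sumr.
under eq_bigr => v _ do rewrite tfun_scaled //.
rewrite sumrB lerBlDr; apply: le_trans.
rewrite [X in _ <= X](big_setID J) /= (setIidPr sJ) -[X in X <= _]addr0.
apply: lerD; last by apply: sumr_ge0 => v _; apply: q_ge0.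
by apply: ler_sum => i _; have := eps0_le_sqr a (f i) (x i); lra.
Qed.

(** Extend [I] to a complete choice, which also contains [J], and drop the other terms, nonnegative
    by [f >= 1] and [h >= 0]. *)
Lemma star_tough_charge (S I J : {set T}) :
  (forall i, i \in I -> starCenter m S i) ->
  (forall i j, i \in I -> j \in I -> sameComp m S i j -> i = j) ->
  J \subset I :|: isoSet m S ->
  \sum_(i in I) ((f i)%:R - 1) + \sum_(v in J) h v + (omega m S)%:R <= #|S|%:R + 1.
Proof.
move=> scI sepI sJ; have [K sIK chK] := star_choice_extend mm scI sepI.
have sJK : J \subset K.
  by apply: subset_trans sJ _; rewrite subUset sIK isolated_in_choice.
apply: le_trans (star_tough chK); rewrite lerD2r.
under [X in _ <= X]eq_bigr => v _ do rewrite addrAC.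
rewrite [X in _ <= X]big_split /= [X in _ <= X + _](big_setID I) /= (setIidPr sIK).
rewrite [X in _ <= _ + X](big_setID J) /= (setIidPr sJK).
rewrite -addrA lerD2l [X in _ <= X]addrCA lerDl addr_ge0 //; last exact: sumr_ge0.
by apply: sumr_ge0 => v _; rewrite subr_ge0 ler1n.
Qed.

Lemma tough_no_barrier (A B : {set T}) : [disjoint A & B] ->
  (omega m (A :|: B) + \sum_(b in B) f b <=
   \sum_(v in A) f v + \sum_(b in B) \sum_(u in ~: A) m b u + 1)%N.
Proof.
move=> dAB; have [I [sIB indI domI charge]] := greedy_charge f mm dAB.
pose x := degOut m A; pose J := [set i in I | (x i <= f i)%N].
have sJI : J \subset I by apply/subsetP=> i; rewrite inE => /andP[].
pose S2 := A :|: [set u | (u \notin A) && [exists i in J, (0 < m i u)%N]].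
have sJ2 : J \subset isoSet m S2.
  apply/subsetP=> i iJ; have iI := subsetP sJI i iJ.
  rewrite !inE (negPf (I_notin_A dAB sIB iI)) /= negb_exists; apply/andP; split.
    apply/forallP=> j; apply/negP=> /andP[/(subsetP sJI) jI].
    by rewrite indI.
  apply/forallP=> u; apply/implyP; rewrite !inE negb_or negb_and => /andP[/negPf uA].
  rewrite uA /= negb_exists => /forallP/(_ i); rewrite iJ /=; lia.
have iso := iso_tough_charge x sJ2.
have star := star_tough_charge (I_starCenter mm dAB sIB indI)
  (I_separated mm dAB sIB indI) (isolated_sub mm dAB sIB indI domI sJI).
have cS2 : #|S2|%:R <= #|A|%:R + \sum_(i in J) (x i)%:R :> R.
  by rewrite -natR -natrD ler_nat; exact: card_outer_nbrs.
pose X := removed m A B I; pose L := full_roots m A B I; pose K := nonfull_roots m A B I.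
have cS1 : #|starDel m A B I|%:R <= #|A|%:R + #|B :\: I|%:R + #|X|%:R :> R.
  rewrite -!natrD ler_nat; apply: leq_trans (leq_card_setU _ _) _.
  by rewrite leq_add2r leq_card_setU.
have cX : #|X|%:R + #|L|%:R <= (\sum_(w in ~: (A :|: B)) edgesI m I w)%N%:R :> R.
  by rewrite -natrD ler_nat; apply: card_removed.
have om : #|I|%:R + #|K|%:R <= (omega m (starDel m A B I))%:R :> R.
  by rewrite -natrD ler_nat; apply: omega_starDel.
have fA : a * #|A|%:R <= \sum_(v in A) (f v)%:R.
  by rewrite -sumr_const mulr_sumr; apply: ler_sum => v _; rewrite mulr1.
rewrite -(ler_nat R) !natrD !natR (omega_full m A B I) natrD -/L -/K.
have {charge} : \sum_(b in B) ((f b)%:R - (x b)%:R) + #|B :\: I|%:R +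
     (\sum_(w in ~: (A :|: B)) edgesI m I w)%N%:R <=
  \sum_(i in J) (x i)%:R * ((f i)%:R - (x i)%:R) + \sum_(i in I) (f i)%:R :> R.
  move: charge; rewrite -(ler_int R) !rmorphD /= !rmorph_sum /= !pmulrn; congr (_ + _ + _ <= _ + _).
  - by apply: eq_bigr => b _; rewrite rmorphB.
  - by apply: eq_big => [i|i _]; rewrite ?inE // rmorphM rmorphB.
move: iso star; rewrite big_split -mulr_sumr /= !sumrB sumr_const.
have -> : \sum_(b in B) (\sum_(u in ~: A) m b u)%N%:R = \sum_(b in B) (x b)%:R :> R by [].
move: (\sum_(i in J) _ * _) (\sum_(i in J) (x i)%:R) cS2 fA cS1 cX om => s1 s2.
move: (\sum_(v in A) _) (\sum_(v in B) (f v)%:R) (\sum_(v in B) (x v)%:R) => fA fB xB.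
move: (\sum_(v in I) _) (\sum_(v in isoSet m S2) _) (\sum_(v in ~: _) _)%N => fI hS eI.
move: #|A|%:R #|S2|%:R #|I|%:R #|K|%:R #|L|%:R #|X|%:R => cA cS cI cK cL cX.
move: #|starDel m A B I|%:R #|B :\: I|%:R (omega _ _)%:R => cD cBI om cS2 fA' cS1 cX' om' iso star ch.
(* After this bound [(a - 1) * s2] and the terms in [h] cancel, and [|A|] gets the coefficient
   [a]. *)
have : (a - 1) * cS <= (a - 1) * (cA + s2) by rewrite ler_pM2l ?subr_gt0.
lra.
Qed.

End Toughness.

Theorem mainTheorem6 (R : archiRealFieldType) (T : finType) (m : T -> T -> nat)
  (f : T -> nat) (a : R) (h : T -> R) :
  multigraph m ->
  (forall v, (0 < f v)%N) ->
  1 < a -> (forall v, a <= (f v)%:R) ->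
  (forall v, 0 <= h v) ->
  iso_tough m (tfun f a h) ->
  (forall S I : {set T}, starCenterChoice m S I ->
     \sum_(v in I) ((f v)%:R + h v - 1) + (omega m S)%:R <= (#|S|)%:R + 1) ->
  near_factor m f.
Proof.
move=> mm f_gt0 a_gt1 a_le_f h_ge0 isoT starT.
have noB := tough_no_barrier mm f_gt0 a_gt1 a_le_f h_ge0 isoT starT.
apply: (near_factor_of_barriers mm _ noB) => v.
(* This gives [f v <= deg m v] as soon as [G - v] is nonempty. *)
have := noB set0 [set v]; rewrite -setI_eq0 set0I eqxx => /(_ isT).
rewrite set0U big_set0 !big_set1 add0n setC0 addn1.
have -> : (\sum_(u in [set: T]) m v u = deg m v)%N by apply: eq_bigl => u; rewrite inE.
have [u uv|only_v] := pickP (fun u => u != v).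
  have : (0 < omega m [set v])%N.
    by apply: (@omega_ge _ _ mm _ [:: u]) => // w; rewrite !inE => /eqP ->.
  by lia.
have d0 : deg m v = 0%N.
  by rewrite /deg big1 // => u _; case: mm => _ m0; have /eqP -> := negbFE (only_v u).
(* On a single vertex only [f v <= 1] was obtained, against [1 < a <= f v]. *)
have : (1 < f v)%N by rewrite -(ltr_nat R); apply: lt_le_trans a_gt1 (a_le_f v).
rewrite d0; lia.
Qed.
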